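(* Let $P$ be a finite poset, $\Bbbk$ a field, $n\ge1$, $i\ge0$, and $R=\bigcup_{j=1}^n\{j\}\times R_j\subseteq[n]\times P$. The Betti number $\beta_{i,R}(L(n,P))$ can be nonzero only if $R_1\le R_2\le\cdots\le R_n$ (in particular all $R_j$ are nonempty).
   Context: $[n]=\{1<\dots<n\}$. The $n$'th letterplace ideal $L(n,P)$ is the ideal in $S=\Bbbk[x_{i,p}:(i,p)\in[n]\times P]$ generated by the monomials $x_{1,p_1}x_{2,p_2}\cdots x_{n,p_n}$ with $p_1\le p_2\le\cdots\le p_n$ in $P$. For $R\subseteq[n]\times P$, $\beta_{i,R}(L(n,P))=\dim_\Bbbk\mathrm{Tor}_i^S(L(n,P),\Bbbk)_R$, where the multidegree $R$ means the $0/1$ exponent vector with support $R$. For nonempty subsets $A,B$ of $P$ write $A\le B$ if: for every maximal element $a$ of $A$ there is a minimal element $b$ of $B$ with $a\le b$, and for every minimal element $b$ of $B$ there is a maximal element $a$ of $A$ with $a\le b$. The relation is only defined between nonempty subsets. *)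

(* Defs.v *)
From mathcomp Require Import all_boot all_order all_algebra.
From mathcomp Require Import finmap monalg.

Set Implicit Arguments.
Unset Strict Implicit.
Unset Printing Implicit Defensive.

Import GRing.Theory.
Local Open Scope ring_scope.

(* The polynomial ring k[x_v : v in V], graded by the multidegrees {cmonom V}:
   a monomial is its exponent vector, and the product of monomials is the sum
   of exponent vectors. *)
Notation polyring k V := {malg k[{cmonom V}]}.

Section Betti.
Context (k : fieldType) (V : finType).
Local Notation S := (polyring k V).
Local Notation multideg := {cmonom V}.

Definition monomial (m : multideg) : S := << m >>.

Definition set_deg (A : {set V}) : multideg :=
  \big[mmul/mone]_(v in A) ucm v.

Definition monomial_ideal (T : finType) (A : {set T}) (m : T -> multideg)
    (f : S) : Prop :=
  exists c : T -> S, f = \sum_(t in A) c t * monomial (m t).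

(* For generators e, e' of degrees a, b, the term g * e' is homogeneous of
   degree a. *)
Definition homog_entry (a b : multideg) (g : S) : Prop :=
  forall m : multideg, m \in msupp g -> mmul m b = a.

(* A multigraded resolution ... -> F_1 -> F_0 -> J -> 0 of the ideal J by free
   modules of finite rank, F_i = S^(fr_rank i) with its a-th basis vector in
   degree fr_deg i a.  Elements of F_i are row vectors, on which the matrices of
   the maps act from the right. *)
Record free_resolution (J : S -> Prop) := FreeResolution {
  fr_rank : nat -> nat;
  fr_deg : forall i, 'I_(fr_rank i) -> multideg;
  fr_aug : 'M[S]_(fr_rank 0, 1);
  fr_diff : forall i, 'M[S]_(fr_rank i.+1, fr_rank i);
  fr_aug_homog : forall a, homog_entry (fr_deg a) mone (fr_aug a 0);
  fr_diff_homog : forall i a b,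
    homog_entry (fr_deg a) (fr_deg b) (fr_diff i a b);
  fr_aug_image : forall f : S, J f <-> exists u, u *m fr_aug = f%:M;
  fr_exact0 : forall u : 'rV[S]_(fr_rank 0),
    u *m fr_aug = 0 <-> exists v, u = v *m fr_diff 0;
  fr_exactS : forall i (u : 'rV[S]_(fr_rank i.+1)),
    u *m fr_diff i = 0 <-> exists v, u = v *m fr_diff i.+1
}.

Section TorDim.
Context (J : S -> Prop) (F : free_resolution J).

(* The complex F (x)_S k: since k = S / (x_v : v in V), the polynomial entries
   are replaced by their constant coefficients. *)
Definition tor_diff i : 'M[k]_(fr_rank F i.+1, fr_rank F i) :=
  map_mx (mcoeff (mone : multideg)) (fr_diff F i).

Definition tor_cycles i : 'M[k]_(fr_rank F i) :=
  if i is j.+1 then kermx (tor_diff j) else 1%:M.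

(* the component of F_i (x)_S k of multidegree m *)
Definition tor_deg i (m : multideg) : 'M[k]_(fr_rank F i) :=
  diag_mx (\row_a (fr_deg a == m)%:R).

(* dim_k Tor_i^S(J, k)_m = dim_k H_i(F (x)_S k)_m, as cycles modulo boundaries
   in multidegree m *)
Definition tor_dim i (m : multideg) : nat :=
  (\rank (tor_cycles i :&: tor_deg i m)%MS
   - \rank (tor_diff i :&: tor_deg i m)%MS)%N.

End TorDim.

(* b is the multigraded Betti number beta_{i,m}(J).  Tor does not depend on the
   resolution, so any resolution may serve to compute it. *)
Definition is_betti (J : S -> Prop) (i : nat) (m : multideg) (b : nat) : Prop :=
  exists F : free_resolution J, tor_dim F i m = b.

End Betti.

Section Letterplace.
Context (n : nat) (d : Order.disp_t) (P : finPOrderType d).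

Definition multichains : {set {ffun 'I_n -> P}} :=
  [set p : {ffun 'I_n -> P} |
     [forall i : 'I_n, forall j : 'I_n, (i <= j)%N ==> (p i <= p j)%O]].

Definition letterplace_monomial (p : {ffun 'I_n -> P}) : {cmonom ('I_n * P)%type} :=
  \big[mmul/mone]_(i < n) ucm (i, p i).

Definition letterplace_ideal (k : fieldType) : polyring k ('I_n * P)%type -> Prop :=
  monomial_ideal multichains letterplace_monomial.

Definition slice (R : {set 'I_n * P}) (j : 'I_n) : {set P} :=
  [set p | (j, p) \in R].

Definition maximals (A : {set P}) : {set P} :=
  [set a in A | [forall x in A, ~~ (a < x)%O]].

Definition minimals (A : {set P}) : {set P} :=
  [set a in A | [forall x in A, ~~ (x < a)%O]].

Definition subset_le (A B : {set P}) : Prop :=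
  [/\ A != set0, B != set0,
      forall a, a \in maximals A -> exists2 b, b \in minimals B & (a <= b)%O
    & forall b, b \in minimals B -> exists2 a, a \in maximals A & (a <= b)%O].

End Letterplace.

(* Main.v *)
Require Import Defs.
From mathcomp Require Import all_boot all_order all_algebra.
From mathcomp Require Import finmap monalg.

(** Let J be the ideal L(n, P), F a multigraded free resolution of J, and R a
    set of variables.  Setting every variable to 1 turns F into a complex of
    k-spaces.  For a set X of variables, the basis vectors whose degree divides
    x^X span a subcomplex V(X), a copy of the strand of F in degree X; so V(X)
    is exact up to its augmentation, whose image is k if x^X lies in J and 0
    otherwise ([strand_exact0], [strand_exactS], [strand_aug], [strand_augV]).
    Inside V(R), the group Tor_i(J, k)_R is the i-th homology of the quotient
    of V(R) by the sum of the V(R minus v), v in R ([tor_dim_cube_exact]).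

    For disjoint s and r let Q(s, r) be V(s u r) modulo the sum of the
    V(s u r minus v) for v in r.  Then Q(s, v u r) is the quotient of
    Q(v u s, r) by Q(s, r), so it is exact when these two are
    ([cube_exact_split]), while Q(s, {v}) is exact when x^(v u s) in J implies
    x^s in J ([cube_exact_edge]).  Unfolding the first rule gives a decision
    tree: the membership in X of the elements of a set A is queried, and for
    every answer Y there has to be one further variable t whose addition to
    a set X with these answers never brings x^X into J.  When such a tree
    exists, Tor(J, k)_R vanishes in all homological degrees
    ([cube_exact_decision]).  The pairs X, t u X form an acyclic matching on
    the subsets of R, as in discrete Morse theory.

    For J = L(n, P), x^X is in J exactly when X contains the graph of a
    multichain ([letterplace_set_deg]).  Let j < j' and let b be in R_j', and
    suppose that no maximal element of R_j is below b.  Let A consist of the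
    elements of R in the layers before j and of those (j, a) with a <= b.
    Given X, either no multichain through X in the layers up to j ends below b,
    and then (j', b) lies on no multichain in X; or one such multichain ends at
    some a <= b.  In that case choose a maximal a' >= a in R_j: it is not below
    b, and every multichain in X through (j, a') can be rerouted through (j, a)
    and the multichain that ends there, because whatever lies above a' lies
    above a ([monotone_splice]).  So (j', b)
    or (j, a') can be added freely, according to what X contains of A
    ([chain_toggle]), and the Betti numbers in degree R vanish.  Reversing both
    the layers and P gives the statement on minimal elements. *)
Set Implicit Arguments.
Unset Strict Implicit.
Unset Printing Implicit Defensive.

Import Order.TTheory GRing.Theory.
Local Open Scope ring_scope.

(** * Decision trees on the subsets of a finite set *)

(** The subsets of [R] with the same trace [Y] on [A] are paired by toggling one
    element [t]: as [t] depends on the trace alone and lies outside [A], toggling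
    it keeps the trace, and the pairing is acyclic. *)
Definition decides {W : finType} (A R : {set W}) (C : {set W} -> Prop) :=
  forall Y : {set W}, Y \subset A -> exists2 t, t \in R :\: A &
    forall X : {set W}, Y \subset X -> X \subset Y :|: (R :\: A) ->
      C (t |: X) -> C X.

(** * Divisibility of monomials *)

Section Divisibility.
Context {V : finType}.
Local Notation multideg := {cmonom V}.
Implicit Types (m p q : multideg) (X : {set V}).

Lemma mmulI p : injective (fun m => mmul m p).
Proof.
move=> m1 m2 E; apply/eqP/cmP => v.
have /eqP := congr1 (fun m : multideg => m v) E.
by rewrite /= !cmM eqn_add2r => /eqP.
Qed.

Definition mdvd p q := [forall v, p v <= q v]%N.

Lemma divcmK p q : mdvd p q -> mmul (divcm q p) p = q.
Proof.
by move=> /forallP pq; apply/eqP/cmP => v; rewrite cmM divcmE subnK.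
Qed.

Lemma mmulK m p : divcm (mmul m p) p = m.
Proof. by apply/eqP/cmP => v; rewrite divcmE cmM addnK. Qed.

Lemma divcm1 m : divcm m mone = m.
Proof. by rewrite -{1}[m]mulm1 mmulK. Qed.

Lemma mdvd_mull m p : mdvd p (mmul m p).
Proof. by apply/forallP => v; rewrite cmM leq_addl. Qed.

Lemma mdvdP p q : reflect (exists m, mmul m p = q) (mdvd p q).
Proof.
apply: (iffP idP) => [/divcmK <-|[m <-]]; first by eexists.
exact: mdvd_mull.
Qed.

Lemma mdvd_trans q p r : mdvd p q -> mdvd q r -> mdvd p r.
Proof.
move=> /forallP pq /forallP qr; apply/forallP => v.
exact: leq_trans (pq v) (qr v).
Qed.

Lemma mdvd_anti p q : mdvd p q -> mdvd q p -> p = q.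
Proof.
move=> /forallP pq /forallP qp; apply/eqP/cmP => v.
by apply/eqP; rewrite eqn_leq pq qp.
Qed.

Lemma mdvd_refl m : mdvd m m.
Proof. exact/forallP. Qed.

Lemma divcm_trans p q r : mdvd p q -> mdvd q r ->
  mmul (divcm r q) (divcm q p) = divcm r p.
Proof.
move=> pq qr; apply: (@mmulI p); rewrite /= -mulmA !divcmK //.
exact: mdvd_trans qr.
Qed.

Lemma set_degE X v : set_deg X v = (v \in X).
Proof.
rewrite /set_deg.
have evM : {morph (fun m : multideg => m v) : m p / mmul m p >-> (m + p)%N}.
  by move=> m p; rewrite cmM.
rewrite (big_morph _ evM (cm1 v)).
under eq_bigr do rewrite cmU.
case: (boolP (v \in X)) => vX.
  by rewrite (bigD1 v) //= eqxx big1 // => u /andP[_ /negbTE ->].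
by rewrite big1 // => u uX; case: eqP => // uv; rewrite -uv uX in vX.
Qed.

End Divisibility.

(** * Homogeneous polynomials *)

Section Coefficients.
Context {k : fieldType} {V : finType}.
Local Notation S := (polyring k V).
Local Notation multideg := {cmonom V}.
Implicit Types (m p q : multideg) (g : S).

Lemma mcoeff_mulmonom g c p q :
  (g * << c *g p >>)@_q = if mdvd p q then g@_(divcm q p) * c else 0.
Proof.
rewrite (monalgE g) mulr_suml !raddf_sum /=.
have E m : (<< g@_m *g m >> * << c *g p >>)@_q =
    (g@_m * c) *+ (mmul m p == q).
  by rewrite malgM_def fgmulUU mcoeffU.
under eq_bigr do rewrite E.
case: ifPn => [pq|npq]; last first.
  rewrite big1 // => m _; case: eqP => // mq.
  by rewrite -mq mdvd_mull in npq.
rewrite mulr_suml; apply: eq_bigr => m _; rewrite mcoeffU.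
rewrite -{1}(divcmK pq) (inj_eq (@mmulI _ p)).
by case: eqP; rewrite ?mul0r.
Qed.

(** The equation m * q = p has at most one solution m, so a homogeneous entry
    is a scalar multiple of a single monomial. *)
Lemma homog_entryE p q g : homog_entry p q g ->
  g = << g@_(divcm p q) *g divcm p q >>.
Proof.
move=> hg; apply/malgP => m; rewrite mcoeffU.
case: eqP => [<-//|ne]; apply/eqP; rewrite mcoeff_eq0; apply/negP => /hg mp.
by apply: ne; rewrite -mp mmulK.
Qed.

Lemma homog_entry_dvd p q g m : homog_entry p q g -> g@_m != 0 -> mdvd q p.
Proof. by rewrite mcoeff_neq0 => hg /hg <-; apply: mdvd_mull. Qed.

End Coefficients.

(** * Homogeneous matrices and the specialisation of all variables to 1 *)

Section HomogeneousMatrices.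
Context {k : fieldType} {V : finType}.
Local Notation S := (polyring k V).
Local Notation multideg := {cmonom V}.
Implicit Types (m : multideg) (U L : pred multideg).

Definition downset U := forall p q, mdvd p q -> U q -> U p.

Definition supp r (da : 'I_r -> multideg) U (c : 'rV[k]_r) : Prop :=
  forall a, ~~ U (da a) -> c 0 a = 0.

(** The inverse of setting the variables to 1, in degree [m]: basis vectors of
    degree [da a] are shifted up to [m]. It is meaningful on vectors supported
    on the degrees dividing [m], since [divcm] truncates at 0. *)
Definition homogenize r (da : 'I_r -> multideg) m (c : 'rV[k]_r) : 'rV[S]_r :=
  \row_a << c 0 a *g divcm m (da a) >>.

(** The component of [u] in degree [m], with the variables set to 1. *)
Definition strand r (da : 'I_r -> multideg) m (u : 'rV[S]_r) : 'rV[k]_r :=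
  \row_a (if mdvd (da a) m then (u 0 a)@_(divcm m (da a)) else 0).

(** For a homogeneous matrix this is the value at 1 of every entry, as an entry
    has only one coefficient. *)
Definition dehomog r s (da : 'I_r -> multideg) (db : 'I_s -> multideg)
    (M : 'M[S]_(r, s)) : 'M[k]_(r, s) :=
  \matrix_(a, b) (M a b)@_(divcm (da a) (db b)).

Lemma homogenizeE r (da : 'I_r -> multideg) m c a :
  homogenize da m c 0 a = << c 0 a *g divcm m (da a) >>.
Proof. exact: mxE. Qed.

Lemma strandE r (da : 'I_r -> multideg) m u a :
  strand da m u 0 a = if mdvd (da a) m then (u 0 a)@_(divcm m (da a)) else 0.
Proof. exact: mxE. Qed.

Lemma dehomogE r s (da : 'I_r -> multideg) (db : 'I_s -> multideg) M a b :
  dehomog da db M a b = (M a b)@_(divcm (da a) (db b)).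
Proof. exact: mxE. Qed.

Lemma coef_homogenize r (da : 'I_r -> multideg) m c a :
  (homogenize da m c 0 a)@_(divcm m (da a)) = c 0 a.
Proof. by rewrite homogenizeE mcoeffUU. Qed.

Lemma homogenize_inj r (da : 'I_r -> multideg) m : injective (homogenize da m).
Proof.
move=> c c' E; apply/rowP => a.
by rewrite -(coef_homogenize da m c) E coef_homogenize.
Qed.

Lemma homogenize0 r (da : 'I_r -> multideg) m : homogenize da m 0 = 0.
Proof.
apply/rowP => a.
by rewrite homogenizeE [X in << X *g _ >>]mxE [RHS]mxE monalgU0.
Qed.

Lemma supp_strand r (da : 'I_r -> multideg) m u :
  supp da (mdvd^~ m) (strand da m u).
Proof. by move=> a /negbTE nam; rewrite strandE nam. Qed.

Lemma homogenizeK r (da : 'I_r -> multideg) m c :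
  supp da (mdvd^~ m) c -> strand da m (homogenize da m c) = c.
Proof.
move=> sc; apply/rowP => a; rewrite strandE homogenizeE mcoeffUU.
by case: ifPn => // /sc ->.
Qed.

Section Fixed.
Context (r s : nat) (da : 'I_r -> multideg) (db : 'I_s -> multideg).
Context (M : 'M[S]_(r, s)).
Hypothesis hM : forall a b, homog_entry (da a) (db b) (M a b).
Local Notation D := (dehomog da db M).

Lemma dehomog_dvd a b : D a b != 0 -> mdvd (db b) (da a).
Proof. by rewrite dehomogE; apply: homog_entry_dvd. Qed.

Lemma entryE a b : M a b = << D a b *g divcm (da a) (db b) >>.
Proof. by rewrite dehomogE; apply: homog_entryE. Qed.

Lemma row_homogenize a : row a M = homogenize db (da a) (row a D).
Proof. by apply/rowP => b; rewrite homogenizeE mxE entryE [row a D 0 b]mxE. Qed.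

Lemma supp_mul U c :
  downset U -> supp da U c -> supp db U (c *m D).
Proof.
move=> dU sc b nUb; rewrite mxE big1 // => a _.
have [->|/dehomog_dvd ba] := eqVneq (D a b) 0; first by rewrite mulr0.
by rewrite sc ?mul0r //; apply: contra nUb; apply: dU.
Qed.

(** [homogenize_mul] and [strand_mul] transport kernels and images between the
    polynomial matrix and its specialisation, one degree at a time. *)
Lemma homogenize_mul m c : supp da (mdvd^~ m) c ->
  homogenize da m c *m M = homogenize db m (c *m D).
Proof.
move=> sc; apply/rowP => b; rewrite homogenizeE mxE [in RHS]mxE raddf_sum /=.
apply: eq_bigr => a _; rewrite homogenizeE entryE malgM_def fgmulUU.
case: (boolP (mdvd (da a) m)) => [am|/sc ->]; last by rewrite mul0r !monalgU0.
have [->|/dehomog_dvd ba] := eqVneq (D a b) 0; first by rewrite mulr0 !monalgU0.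
by rewrite divcm_trans.
Qed.

Lemma strand_mul m u : strand db m (u *m M) = strand da m u *m D.
Proof.
apply/rowP => b; rewrite strandE mxE [RHS]mxE.
case: ifPn => [bm|nbm]; last first.
  rewrite big1 // => a _; rewrite strandE.
  have [->|/dehomog_dvd ba] := eqVneq (D a b) 0; first by rewrite mulr0.
  by case: ifPn => [am|]; rewrite ?mul0r // (mdvd_trans ba am) in nbm *.
rewrite raddf_sum /=; apply: eq_bigr => a _.
rewrite entryE mcoeff_mulmonom strandE.
have [->|/dehomog_dvd ba] := eqVneq (D a b) 0.
  by rewrite !mulr0; case: ifP.
have -> : mdvd (divcm (da a) (db b)) (divcm m (db b)) = mdvd (da a) m.
  apply/mdvdP/idP => [[q Eq]|am].
    apply/mdvdP; exists q.
    by rewrite -(divcmK ba) mulmA Eq divcmK.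
  by exists (divcm m (da a)); rewrite divcm_trans.
case: ifPn => am; last by rewrite mul0r.
by rewrite -(divcm_trans ba am) mmulK.
Qed.
End Fixed.
End HomogeneousMatrices.

(** * The strands of a resolution *)

Section Strands.
Context {k : fieldType} {V : finType} (J : polyring k V -> Prop).
Context (F : free_resolution J).
Local Notation S := (polyring k V).
Local Notation multideg := {cmonom V}.
Implicit Types (m : multideg) (U L : pred multideg) (X s r : {set V}).

Local Notation deg i := (@fr_deg _ _ _ F i).
Local Notation sp i := (supp (deg i)).

Definition ddiff i : 'M[k]_(fr_rank F i.+1, fr_rank F i) :=
  dehomog (deg i.+1) (deg i) (fr_diff F i).

Definition mdeg0 : 'I_1 -> multideg := fun=> mone.

Definition daug : 'M[k]_(fr_rank F 0, 1) :=
  dehomog (deg 0) mdeg0 (fr_aug F).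

Let hdiff i : forall a b, homog_entry (deg i.+1 a) (deg i b) (fr_diff F i a b).
Proof. exact: fr_diff_homog. Qed.

Let haug : forall a b, homog_entry (deg 0 a) (mdeg0 b) (fr_aug F a b).
Proof. by move=> a b; rewrite [b]ord1; apply: fr_aug_homog. Qed.

Lemma homogenize_const m (c : 'M[k]_1) :
  homogenize mdeg0 m c = << c 0 0 *g m >>%:M.
Proof.
apply/rowP => b; rewrite [b]ord1 homogenizeE [RHS]mxE eqxx mulr1n.
by rewrite /mdeg0 divcm1.
Qed.

(** A row of a differential is the homogenization of a row of its
    specialisation, so this follows by injectivity from the polynomial
    identity. *)
Lemma ddiff_aug : ddiff 0 *m daug = 0.
Proof.
apply/row_matrixP => a; rewrite row_mul row0.
apply: (@homogenize_inj _ _ _ mdeg0 (deg 1 a)).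
rewrite -(homogenize_mul (@haug)); last first.
  by move=> b; rewrite mxE; apply: contraNeq; apply: dehomog_dvd.
rewrite -row_homogenize // homogenize0; apply/fr_exact0.
by exists (delta_mx 0 a); rewrite rowE.
Qed.

Lemma ddiff_ddiff i : ddiff i.+1 *m ddiff i = 0.
Proof.
apply/row_matrixP => a; rewrite row_mul row0.
apply: (@homogenize_inj _ _ _ (deg i) (deg i.+2 a)).
rewrite -(homogenize_mul (@hdiff i)); last first.
  by move=> b; rewrite mxE; apply: contraNeq; apply: dehomog_dvd.
rewrite -row_homogenize // homogenize0; apply/fr_exactS.
by exists (delta_mx 0 a); rewrite rowE.
Qed.

Lemma strand_exactS i m (c : 'rV[k]_(fr_rank F i.+1)) :
  sp i.+1 (mdvd^~ m) c -> c *m ddiff i = 0 ->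
  exists2 w, sp i.+2 (mdvd^~ m) w & c = w *m ddiff i.+1.
Proof.
move=> sc cD0; have := homogenize_mul (@hdiff i) sc.
rewrite -/(ddiff i) cD0 homogenize0 => /fr_exactS[v Ev].
exists (strand (deg i.+2) m v); first exact: supp_strand.
by rewrite -(homogenizeK sc) Ev (strand_mul (@hdiff i.+1)).
Qed.

Lemma strand_exact0 m (c : 'rV[k]_(fr_rank F 0)) :
  sp 0 (mdvd^~ m) c -> c *m daug = 0 ->
  exists2 w, sp 1 (mdvd^~ m) w & c = w *m ddiff 0.
Proof.
move=> sc cD0; have := homogenize_mul (@haug) sc.
rewrite -/daug cD0 homogenize0 => /fr_exact0[v Ev].
exists (strand (deg 1) m v); first exact: supp_strand.
by rewrite -(homogenizeK sc) Ev (strand_mul (@hdiff 0)).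
Qed.

(** With [strand_augV]: the strand in degree [m] has nonzero augmentation
    exactly when the monomial of degree [m] lies in the ideal. *)
Lemma strand_aug m (c : 'rV[k]_(fr_rank F 0)) :
  sp 0 (mdvd^~ m) c -> c *m daug != 0 -> J (monomial k m).
Proof.
move=> sc cD0; have := homogenize_mul (@haug) sc.
rewrite -/daug homogenize_const; set e := (_ *m _) 0 0 => E.
have e0 : e != 0.
  apply: contraNneq cD0 => e0; apply/eqP/rowP => b.
  by rewrite [b]ord1 [RHS]mxE.
have -> : monomial k m = e^-1%:MP * << e *g m >>.
  by rewrite malgM_def fgmulUU mul1m mulVf.
apply/(fr_aug_image F); exists (e^-1%:MP *: homogenize (deg 0) m c).
by rewrite -scalemxAl E scale_scalar_mx.
Qed.

Lemma strand_augV m : J (monomial k m) ->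
  exists2 c : 'rV[k]_(fr_rank F 0), sp 0 (mdvd^~ m) c & c *m daug = 1%:M.
Proof.
move=> /(fr_aug_image F)[u Eu].
exists (strand (deg 0) m u); first exact: supp_strand.
rewrite -(strand_mul (@haug)) Eu; apply/rowP => b.
have m1 : mdvd mone m by apply/mdvdP; exists m; rewrite mulm1.
rewrite strandE [b]ord1 m1 !mxE eqxx !mulr1n /monomial mcoeffU.
by rewrite divcm1 eqxx.
Qed.

(** * Relative exactness *)

(** Cycles and vanishing homology of the quotient complex of the vectors
    supported on [U] by those supported on [L].  In homological degree 0 every
    vector is a cycle: the augmentation is left out, as in the definition of
    Tor. *)
Definition rel_cycle L i : 'rV[k]_(fr_rank F i) -> Prop :=
  if i is j.+1 then fun c => sp j L (c *m ddiff j) else fun=> True.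

Definition rel_exact U L := forall i (c : 'rV[k]_(fr_rank F i)),
  sp i U c -> rel_cycle L c ->
  exists2 w, sp i.+1 U w & sp i L (c - w *m ddiff i).

Lemma suppD i U (c c' : 'rV[k]_(fr_rank F i)) :
  sp i U c -> sp i U c' -> sp i U (c + c').
Proof. by move=> sc sc' a nU; rewrite mxE sc // sc' // addr0. Qed.

Lemma suppN i U (c : 'rV[k]_(fr_rank F i)) : sp i U c -> sp i U (- c).
Proof. by move=> sc a nU; rewrite mxE sc // oppr0. Qed.

Lemma suppB i U (c c' : 'rV[k]_(fr_rank F i)) :
  sp i U c -> sp i U c' -> sp i U (c - c').
Proof. by move=> sc sc'; apply/suppD/suppN. Qed.

Lemma suppS i U U' (c : 'rV[k]_(fr_rank F i)) :
  (forall m, U m -> U' m) -> sp i U c -> sp i U' c.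
Proof. by move=> UU' sc a nU; apply: sc; apply: contra nU => /UU'. Qed.

Lemma supp_ddiff i U (c : 'rV[k]_(fr_rank F i.+1)) :
  downset U -> sp i.+1 U c -> sp i U (c *m ddiff i).
Proof. by move=> dU; apply: (supp_mul (@hdiff i) dU). Qed.

Lemma supp_split i U L (c : 'rV[k]_(fr_rank F i)) :
  sp i (predU L U) c -> exists2 c', sp i U c' & sp i L (c - c').
Proof.
move=> sc; exists (\row_a if U (deg i a) then c 0 a else 0) => a.
  by move/negbTE => nU; rewrite mxE nU.
move=> nL; rewrite !mxE; case: ifPn => [_|nU]; first by rewrite subrr.
by rewrite subr0 sc //= negb_or nL.
Qed.

(** Third isomorphism theorem and long exact sequence: with V_U denoting the
    vectors supported on U, the complex V_U0 / (V_L0 + V_U1) is the quotient of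
    V_U0 / V_L0 by V_U1 / (V_L0 n V_U1). *)
Lemma rel_exact_quot U0 L0 U1 :
  downset U0 -> downset L0 -> downset U1 -> (forall m, U1 m -> U0 m) ->
  rel_exact U0 L0 -> rel_exact U1 (predI L0 U1) ->
  rel_exact U0 (predU L0 U1).
Proof.
move=> dU0 dL0 dU1 U10 ex0 ex1 i c sc cc.
(* Correct the cycle by a chain of the subcomplex, so that it becomes a cycle
   modulo L0 alone: the U1 part of its boundary is itself a cycle. *)
have [v sv cv] : exists2 v, sp i U1 v & rel_cycle L0 (c - v).
  case: i => [|i] in c sc cc *.
    by exists 0 => // a _; rewrite mxE.
  have [q sq pq] := supp_split cc.
  have cq : rel_cycle (predI L0 U1) q.
    case: i => [//|i] in c sc cc q sq pq *.
    move=> a /nandP[nL|nU]; last by apply: supp_ddiff nU.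
    have := supp_ddiff dL0 pq nL.
    by rewrite mulmxBl -mulmxA ddiff_ddiff mulmx0 sub0r mxE => /eqP;
      rewrite oppr_eq0 => /eqP.
  have [v sv Ev] := ex1 _ _ sq cq; exists v => //=.
  rewrite mulmxBl -(subrK q (c *m _)) -addrA; apply: suppD => //.
  by apply: suppS Ev => m /andP[].
have [w sw Ew] := ex0 _ _ (suppB sc (suppS U10 sv)) cv.
exists w => //.
have -> : c - w *m ddiff i = (c - v - w *m ddiff i) + v.
  by rewrite addrAC subrK.
by apply: suppD; [apply: suppS Ew | apply: suppS sv] => m /= ->; rewrite ?orbT.
Qed.

(** * Cubes of strands *)

Definition below X : pred multideg := mdvd^~ (set_deg X).

(** Within the divisors of x^(s u r), the degrees that miss some variable of
    [r]: they support the sum of the strands in degrees s u r minus v. *)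
Definition boundary (s r : {set V}) : pred multideg :=
  fun m => below (s :|: r) m && [exists v in r, m v == 0%N].

(** Exactness of Q(s, r); in terms of the cube of complexes V(s u X), for X a
    subset of [r], this is the total cofibre of the cube. *)
Definition cube_exact (s r : {set V}) :=
  rel_exact (below (s :|: r)) (boundary s r).

Lemma belowP X m : reflect (forall v, m v <= (v \in X))%N (below X m).
Proof.
by apply: (iffP forallP) => H v; have := H v; rewrite set_degE.
Qed.

Lemma downset_below X : downset (below X).
Proof. by move=> p q; apply: mdvd_trans. Qed.

Lemma downset_boundary s r : downset (boundary s r).
Proof.
move=> p q pq /andP[sq /exists_inP[v vr /eqP qv]]; apply/andP; split.
  exact: downset_below pq sq.
apply/exists_inP; exists v => //; have /forallP/(_ v) := pq.
by rewrite qv leqn0.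
Qed.

Lemma eq_rel_exact U U' L L' : U =1 U' -> L =1 L' ->
  rel_exact U L -> rel_exact U' L'.
Proof.
move=> eU eL ex i c sc cc.
have sub W W' j (x : 'rV[k]_(fr_rank F j)) : W =1 W' -> sp j W x -> sp j W' x.
  by move=> eW; apply: suppS => m; rewrite eW.
have [||w sw Ew] := ex i c.
- by apply: sub sc => m; rewrite eU.
- by case: i c sc cc => //= i c sc; apply: sub => m; rewrite eL.
by exists w; [apply: sub sw | apply: sub Ew].
Qed.

(** The cube over v u r has two opposite faces, over r at s and at v u s, and
    its cofibre is the cofibre of the map between theirs. *)
Lemma cube_exact_split s r v : v \notin s :|: r ->
  cube_exact (v |: s) r -> cube_exact s r -> cube_exact s (v |: r).
Proof.
move=> vsr ex0 ex1.
have E : (v |: s) :|: r = v |: (s :|: r) by rewrite setUA.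
have E' : s :|: (v |: r) = v |: (s :|: r) by rewrite setUCA.
have sub1 m : below (s :|: r) m -> below (v |: (s :|: r)) m.
  move/belowP => H; apply/belowP => u; apply: leq_trans (H u) _.
  by rewrite in_setU1; case: (u \in s :|: r); rewrite ?orbT.
have bv m : below (v |: (s :|: r)) m ->  m v = 0%N -> below (s :|: r) m.
  move=> /belowP H mv; apply/belowP => u; have := H u; rewrite in_setU1.
  by case: eqP => [->|]; rewrite ?mv.
have ex : rel_exact (below (v |: s :|: r))
    (predU (boundary (v |: s) r) (below (s :|: r))).
  apply: rel_exact_quot => //.
  - exact: downset_below.
  - exact: downset_boundary.
  - exact: downset_below.
  - by move=> m; rewrite E; apply: sub1.
  apply: eq_rel_exact ex1 => // m; rewrite /= /boundary E.
  case: (boolP (below (s :|: r) m)) => [sm|_]; last by rewrite andbF.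
  by rewrite sub1 // andbT.
apply: eq_rel_exact ex => m; first by rewrite E E'.
rewrite /= /boundary E E'; apply/orP/andP.
  case=> [/andP[sm /exists_inP[u ur mu]]|sm]; split=> //.
  - by apply/exists_inP; exists u => //; rewrite in_setU1 ur orbT.
  - exact: sub1.
  apply/exists_inP; exists v; first exact: setU11.
  by have /belowP/(_ v) := sm; rewrite (negbTE vsr) leqn0.
case=> sm /exists_inP[u]; rewrite in_setU1 => /orP[/eqP->|ur] mu.
  by right; apply: bv => //; apply/eqP.
by left; rewrite sm; apply/exists_inP; exists u.
Qed.

Local Notation Jset X := (J (monomial k (set_deg X))).

(** As J is an ideal, the hypothesis says that the monomials of degrees s and
    v u s are both in J or both outside J: then the inclusion of V(s) in V(v u s) is a quasi-isomorphism, so its cofibre is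
    exact. *)
Lemma cube_exact_edge s v : v \notin s -> (Jset (v |: s) -> Jset s) ->
  cube_exact s [set v].
Proof.
move=> vs Js.
have sub1 m : below s m -> boundary s [set v] m.
  move/belowP => H; apply/andP; split.
    apply/belowP => u; apply: leq_trans (H u) _.
    by rewrite in_setU; case: (u \in s).
  apply/exists_inP; exists v; first by rewrite inE.
  by have := H v; rewrite (negbTE vs) leqn0.
have sub2 m : boundary s [set v] m -> below s m.
  move=> /andP[/belowP H /exists_inP[u]]; rewrite inE => /eqP -> mv.
  apply/belowP => w; have := H w; rewrite in_setU in_set1.
  by case: eqP => [->|]; rewrite ?(eqP mv) ?orbF.
have sub3 m : below s m -> below (s :|: [set v]) m by case/sub1/andP.
move=> i c sc cc; case: i => [|i] in c sc cc *.
  have [c0|c0] := eqVneq (c *m daug) 0.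
    have [w sw Ew] := strand_exact0 sc c0.
    by exists w => //; rewrite -Ew subrr => a _; rewrite mxE.
  have /Js/strand_augV[c' sc' c'1] : Jset (v |: s).
    by apply: strand_aug c0; rewrite setUC.
  (* [c'] generates the augmentation of V(s), so subtracting a multiple of it
     makes [c] a cycle. *)
  pose e := (c *m daug) 0 0.
  have sc'' : sp 0 (below s) (e *: c').
    by move=> a na; rewrite mxE sc' ?mulr0.
  have [||w sw Ew] := @strand_exact0 (set_deg (s :|: [set v])) (c - e *: c').
  - by apply: suppB => //; apply: suppS sc''.
  - by rewrite mulmxBl -scalemxAl c'1 scale_scalar_mx mulr1 -mx11_scalar subrr.
  exists w => //; rewrite -Ew opprB addrC subrK.
  exact: suppS sc''.
(* The boundary of [c] is a cycle of V(s), hence the boundary of some [v'] in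
   V(s), and c - v' is a cycle of V(v u s). *)
have cs : sp i (below s) (c *m ddiff i) by apply: suppS cc.
have [v' sv' Ev'] : exists2 v', sp i.+1 (below s) v' &
    c *m ddiff i = v' *m ddiff i.
  case: i => [|i] in c sc cc cs *.
    by apply: strand_exact0 => //; rewrite -mulmxA ddiff_aug mulmx0.
  by apply: strand_exactS => //; rewrite -mulmxA ddiff_ddiff mulmx0.
have [||w sw Ew] := @strand_exactS i (set_deg (s :|: [set v])) (c - v').
- by apply: suppB => //; apply: suppS sv'.
- by rewrite mulmxBl Ev' subrr.
exists w => //; rewrite -Ew opprB addrC subrK.
exact: suppS sv'.
Qed.

Lemma cube_exact0 s : ~ Jset s -> cube_exact s set0.
Proof.
move=> nJ i c sc cc.
have [w sw Ew] : exists2 w, sp i.+1 (below (s :|: set0)) w & c = w *m ddiff i.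
  case: i => [|i] in c sc cc *.
    apply: strand_exact0 => //; apply/eqP/negPn/negP => /strand_aug nz.
    by apply: nJ; apply: nz; rewrite -[s in set_deg s]setU0.
  apply: strand_exactS => //; apply/rowP => b; rewrite [RHS]mxE; apply: cc.
  by apply/nandP; right; apply/exists_inP => -[u]; rewrite inE.
by exists w => //; rewrite -Ew subrr => a _; rewrite mxE.
Qed.

Lemma disjointsU1 v s r :
  [disjoint v |: s & r] = (v \notin r) && [disjoint s & r].
Proof. by rewrite -!setI_eq0 setIUl setU_eq0 !setI_eq0 disjoints1. Qed.

(** Querying the elements of [r1] one by one reduces a cube to its faces in the
    directions [r2], one for each subset of [r1]. *)
Lemma cube_exact_faces s r1 r2 :
  [disjoint s & r1] -> [disjoint s & r2] -> [disjoint r1 & r2] ->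
  (forall X, X \subset r1 -> cube_exact (X :|: s) r2) ->
  cube_exact s (r1 :|: r2).
Proof.
elim: {r1}#|r1| {-2}r1 (erefl #|r1|) s => [|n IHn] r1 Er1 s s1 s2 r12 ex.
  have r10 : r1 = set0 by apply/eqP; rewrite -cards_eq0 Er1.
  by rewrite r10 set0U -[s]set0U; apply: ex; rewrite sub0set.
have /card_gt0P[v vr1] : (0 < #|r1|)%N by rewrite Er1.
have vs : v \notin s by rewrite (disjointFl s1 vr1).
have vr2 : v \notin r2 by rewrite (disjointFr r12 vr1).
have En : #|r1 :\ v| = n by move: Er1; rewrite (cardsD1 v) vr1 => -[].
have sub1 : r1 :\ v \subset r1 by apply: subD1set.
have r12' : [disjoint r1 :\ v & r2] by apply: disjointWl sub1 r12.
rewrite -(setD1K vr1) -setUA; apply: cube_exact_split.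
- by rewrite !inE eqxx (negbTE vs) (negbTE vr2).
- apply: IHn => //.
  + by rewrite disjointsU1 setD11; apply: disjointWr sub1 s1.
  + by rewrite disjointsU1 vr2.
  move=> X Xr; have -> : X :|: (v |: s) = (v |: X) :|: s by rewrite setUCA setUA.
  by apply: ex; rewrite subUset sub1set vr1; apply: subset_trans sub1.
apply: IHn => //; first by apply: disjointWr sub1 s1.
by move=> X Xr; apply: ex; apply: subset_trans sub1.
Qed.

Lemma cube_exact_void r :
  (forall X, X \subset r -> ~ Jset X) -> cube_exact set0 r.
Proof.
move=> nJ; rewrite -[r]setU0; apply: cube_exact_faces => [||| X Xr];
  try by rewrite -setI_eq0 ?set0I ?setI0.
by apply: cube_exact0; rewrite setU0; apply: nJ.
Qed.

(** The element [v] is queried last: the faces left are edges in direction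
    [v]. *)
Lemma cube_exact_toggle s r v : [disjoint s & r] -> v \in r -> v \notin s ->
  (forall X, s \subset X -> X \subset s :|: r -> Jset (v |: X) -> Jset X) ->
  cube_exact s r.
Proof.
move=> sr vr vs Jv; rewrite -(setD1K vr) setUC.
apply: cube_exact_faces.
- by apply: disjointWr (subD1set _ _) sr.
- by rewrite disjoint_sym disjoints1.
- by rewrite disjoint_sym disjoints1 !inE eqxx.
move=> X Xr; apply: cube_exact_edge.
  by rewrite inE negb_or vs andbT; apply: contraTN Xr => vX;
    apply/subsetPn; exists v; rewrite // !inE eqxx.
apply: Jv; first exact: subsetUr.
rewrite setUC; apply: setUS; apply: subset_trans Xr _; exact: subD1set.
Qed.

Lemma cube_exact_decision (A R : {set V}) : A \subset R ->
  decides A R (fun X => Jset X) -> cube_exact set0 R.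
Proof.
move=> AR dec; rewrite -(setID R A) (setIidPr AR).
have disj : [disjoint A & R :\: A].
  by rewrite -setI_eq0 setDE setICA setICr setI0.
apply: cube_exact_faces => //; try by rewrite -setI_eq0 set0I.
move=> Y YA; rewrite setU0; have [v vRA Jv] := dec Y YA.
have YRA : [disjoint Y & R :\: A] by apply: disjointWl YA disj.
by apply: cube_exact_toggle Jv; rewrite ?(disjointFl YRA).
Qed.

(** * Tor as the homology of a cube *)

(** The constant coefficient of an entry c * x^(p - q) is c if p = q and 0
    otherwise. *)
Lemma tor_diffE i a b :
  tor_diff F i a b = if deg i.+1 a == deg i b then ddiff i a b else 0.
Proof.
rewrite /tor_diff mxE (entryE (@hdiff i)) -/(ddiff i) mcoeffU.
case: (eqVneq (deg i.+1 a)) => [->|ab].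
  by rewrite -{1}[deg i b]mul1m mmulK eqxx.
have [->|/(dehomog_dvd (@hdiff i)) ba] := eqVneq (ddiff i a b) 0.
  by rewrite mul0rn.
case: eqP => // d1; case/eqP: ab.
by rewrite -(divcmK ba) d1 mul1m.
Qed.

Lemma tor_degE i m (c : 'rV[k]_(fr_rank F i)) a :
  (c *m tor_deg F i m) 0 a = if deg i a == m then c 0 a else 0.
Proof.
by rewrite mul_mx_diag !mxE; case: ifP => _; rewrite ?mulr1 ?mulr0.
Qed.

Lemma sub_tor_degP i m (c : 'rV[k]_(fr_rank F i)) :
  reflect (sp i (pred1 m) c) (c <= tor_deg F i m)%MS.
Proof.
apply: (iffP idP) => [/submxP[w ->] a /negbTE /= am|sc].
  by rewrite tor_degE am.
apply/submxP; exists c; apply/rowP => a; rewrite tor_degE.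
by case: ifPn => // /sc.
Qed.

(** A divisor of x^r in which no variable of r is missing is x^r itself, so the
    quotient Q(0, r) is spanned by the basis vectors of degree exactly r. *)
Lemma top_degree r m : below r m -> ~~ boundary set0 r m -> m = set_deg r.
Proof.
move=> rm; rewrite /boundary set0U rm /= => /exists_inPn nz.
apply/eqP/cmP => v; rewrite set_degE; have /belowP/(_ v) := rm.
by case: (boolP (v \in r)) => [/nz|_]; case: (m v) => [|[]].
Qed.

Lemma supp_top i r (c : 'rV[k]_(fr_rank F i)) :
  sp i (pred1 (set_deg r)) c -> sp i (below (set0 :|: r)) c.
Proof.
by apply: suppS => m /eqP ->; rewrite set0U; apply: mdvd_refl.
Qed.

Lemma tor_diff_mul i m (c : 'rV[k]_(fr_rank F i.+1)) b :
  sp i.+1 (pred1 m) c -> deg i b = m ->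
  (c *m tor_diff F i) 0 b = (c *m ddiff i) 0 b.
Proof.
move=> sc bm; rewrite !mxE; apply: eq_bigr => a _; rewrite tor_diffE bm.
by case: (boolP (_ == m)) => // /sc ->; rewrite !mul0r.
Qed.

(** Q(0, r) is the component in degree x^r of F tensored with k: both have the
    basis vectors of that degree, and the same differential. *)
Lemma tor_dim_cube_exact r i :
  cube_exact set0 r -> tor_dim F i (set_deg r) = 0%N.
Proof.
move=> ex; set m := set_deg r.
apply/eqP; rewrite subn_eq0; apply: mxrankS.
apply/rV_subP => c; rewrite !sub_capmx => /andP[cc /[dup] cm ->].
rewrite andbT; have {cm} sc : sp i (pred1 m) c by apply/sub_tor_degP.
have sbc : sp i (below (set0 :|: r)) c by apply: supp_top.
have cyc : rel_cycle (boundary set0 r) c.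
  case: i => [//|i] in c cc sc sbc *.
  move=> b nb; have [rb|nrb] := boolP (below (set0 :|: r) (deg i b)); last first.
    exact: (supp_ddiff (@downset_below _) sbc nrb).
  rewrite set0U in rb; rewrite -(tor_diff_mul sc (top_degree rb nb)).
  by have /sub_kermxP -> := cc; rewrite mxE.
have [w sw Ew] := ex i c sbc cyc.
apply/submxP; exists (w *m tor_deg F i.+1 m); apply/rowP => b.
have sw' : sp i.+1 (pred1 m) (w *m tor_deg F i.+1 m).
  by apply/sub_tor_degP; apply: submxMl.
have [bm|nbm] := eqVneq (deg i b) m; last first.
  rewrite sc // mxE big1 // => a _; rewrite tor_diffE.
  have [am|/sw' ->] := boolP (deg i.+1 a == m); last by rewrite mul0r.
  by rewrite (eqP am) eq_sym (negbTE nbm) mulr0.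
rewrite (tor_diff_mul sw' bm).
have nb : ~~ boundary set0 r (deg i b).
  rewrite bm; apply/nandP; right; apply/exists_inP => -[v vr].
  by rewrite set_degE vr.
have /eqP := Ew b nb; rewrite [_ 0 b]mxE [X in _ + X]mxE subr_eq0 => /eqP ->.
rewrite mxE [RHS]mxE; apply: eq_bigr => a _; rewrite tor_degE.
case: ifPn => [//|am]; rewrite mul0r.
have [wa|nwa] := boolP (below (set0 :|: r) (deg i.+1 a)); last by rewrite sw ?mul0r.
have [->|/(dehomog_dvd (@hdiff i)) ba] := eqVneq (ddiff i a b) 0.
  by rewrite mulr0.
(* A nonzero contribution to degree x^r comes from a degree that divides x^r
   and is divisible by it. *)
case/eqP: am; apply: mdvd_anti; last by rewrite -bm.
by rewrite set0U in wa.
Qed.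

End Strands.

(** * Splicing multichains *)

Section Splicing.
Context {I T : finType} (leI : rel I) (leT : rel T).
Hypothesis leI_total : total leI.
Hypothesis leI_trans : transitive leI.
Hypothesis leT_trans : transitive leT.
Implicit Types (X Y R : {set I * T}) (f g : {ffun I -> T}).

Definition monotone f := [forall i, forall i', leI i i' ==> leT (f i) (f i')].

Definition has_chain X := exists2 f, monotone f & forall i, (i, f i) \in X.

Lemma monotoneP f :
  reflect (forall i i', leI i i' -> leT (f i) (f i')) (monotone f).
Proof.
apply: (iffP forallP) => [mf i i' ii'|mf i].
  by have /forallP/(_ i')/implyP := mf i; apply.
by apply/forallP => i'; apply/implyP; apply: mf.
Qed.

(** Following [g] up to layer [j] and [f] afterwards stays monotone, since a
    later value of [f] lies above [f j], hence above [g j]. *)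
Lemma monotone_splice j f g : monotone f -> monotone g -> leT (g j) (f j) ->
  monotone [ffun i => if leI i j then g i else f i].
Proof.
move=> /monotoneP mf /monotoneP mg gf; apply/monotoneP => i i' ii'.
rewrite !ffunE; case: ifPn => [ij|nij]; case: ifPn => [i'j|ni'j].
- exact: mg.
- have ji' : leI j i' by move: (leI_total j i'); rewrite (negbTE ni'j) orbF.
  by apply: leT_trans (mg _ _ ij) _; apply: leT_trans gf _; apply: mf.
- by rewrite (leI_trans ii' i'j) in nij.
- exact: mf.
Qed.

(** What has to be known of a set in order to tell which multichains of the
    layers up to [j] end below [b] inside it. *)
Definition initial_part R j b :=
  [set x in R | leI x.1 j && ((x.1 == j) ==> leT x.2 b)].

(** If some chain in [Y] reaches layer [j] at an element g j <= b, an element a'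
    above g j can be added freely: a chain through it may follow g instead.  The
    condition that a' is not below b keeps (j, a') out of the queried part.  If
    no chain in [Y] ends below [b], then no chain passes through (j', b).  The
    relations are arbitrary so that the lemma also applies to the opposite
    orders. *)
Lemma chain_toggle R j j' b : leI j j' -> ~~ leI j' j -> (j', b) \in R ->
  (forall a, (j, a) \in R -> leT a b ->
     exists a', [/\ (j, a') \in R, leT a a' & ~~ leT a' b]) ->
  decides (initial_part R j b) R has_chain.
Proof.
move=> jj' nj'j Rb incr Y YA; set A := initial_part R j b in YA *.
have jj : leI j j by have := leI_total j j; rewrite orbb.
pose reach g := [&& monotone g, [forall i, leI i j ==> ((i, g i) \in Y)] &
                 leT (g j) b].
case: (boolP [exists g, reach g]) => [/existsP[g]|noreach].
  case/and3P => mg /forallP gY gb.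
  have gjY : (j, g j) \in Y by have /implyP := gY j; apply.
  have gjR : (j, g j) \in R.
    by have /(subsetP YA) := gjY; rewrite inE => /andP[].
  have [a' [a'R ga' na'b]] := incr _ gjR gb.
  exists (j, a'); first by rewrite !inE a'R eqxx (negbTE na'b) !andbF.
  move=> X YX _ [f mf fX].
  have [fa'|nfa'] := eqVneq (f j) a'; last first.
    exists f => // i; have := fX i; rewrite in_setU1 => /orP[/eqP[ij fi]|//].
    by rewrite -ij fi eqxx in nfa'.
  exists [ffun i => if leI i j then g i else f i].
    by apply: monotone_splice; rewrite ?fa'.
  move=> i; rewrite ffunE; case: ifPn => [ij|nij].
    by apply: (subsetP YX); have /implyP := gY i; apply.
  have := fX i; rewrite in_setU1 => /orP[/eqP[ij _]|//].
  by rewrite ij jj in nij.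
exists (j', b); first by rewrite !inE Rb (negbTE nj'j).
move=> X YX XA [f mf fX].
have [fb|nfb] := eqVneq (f j') b; last first.
  exists f => // i; have := fX i; rewrite in_setU1 => /orP[/eqP[ij fi]|//].
  by rewrite -ij fi eqxx in nfb.
case/existsP: noreach; exists f; have /monotoneP mf' := mf.
have fjb : leT (f j) b by rewrite -fb; apply: mf'.
apply/and3P; split=> //; apply/forallP => i; apply/implyP => ij.
have := fX i; rewrite in_setU1 => /orP[/eqP[i_j' _]|/(subsetP XA)].
  by rewrite -i_j' ij in nj'j.
rewrite in_setU => /orP[//|]; rewrite !inE ij /= => /andP[nA iR].
move: nA; rewrite iR /=.
by case: eqP => //= ->; rewrite fjb.
Qed.

End Splicing.

Lemma has_chain_op {I T : finType} (leI : rel I) (leT : rel T) X :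
  has_chain (fun i i' => leI i' i) (fun p q => leT q p) X <-> has_chain leI leT X.
Proof.
split=> -[f /monotoneP mf fX]; exists f => //; apply/monotoneP => i i' ii'.
  exact: (mf i' i).
exact: (mf i' i).
Qed.

(** Stated for an arbitrary strict order, to cover maximal and minimal elements
    at once: among [a] and the elements above it, one with the most predecessors
    is maximal. *)
Lemma exists_extremal {T : finType} (lt : rel T) (A : {set T}) a :
  irreflexive lt -> transitive lt -> a \in A ->
  exists2 b, (b == a) || lt a b & b \in [set x in A | [forall y in A, ~~ lt x y]].
Proof.
move=> irr tr aA.
pose P b := (b \in A) && ((b == a) || lt a b).
have Pa : P a by rewrite /P aA eqxx.
case: (arg_maxnP (fun b => #|[set y | lt y b]|) Pa) => b /andP[bA ab] bmax.
exists b => //; rewrite inE bA; apply/forall_inP => y yA.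
apply/negP => by_; have ay : lt a y.
  by case/orP: ab => [/eqP <-//|ab]; apply: tr by_.
have := bmax y; rewrite /P yA ay orbT => /(_ isT).
apply/negP; rewrite -ltnNge; apply: proper_card; apply/properP; split.
  by apply/subsetP => z; rewrite !inE => zb; apply: tr by_.
by exists b; rewrite !inE ?irr.
Qed.

(** * Monomials of the letterplace ideal *)

Section Letterplace.
Context {k : fieldType} (n : nat) (d : Order.disp_t) (P : finPOrderType d).
Local Notation V := ('I_n * P)%type.
Implicit Types (X R : {set V}).

Lemma monomial_in_ideal (W T : finType) (A : {set T}) (mu : T -> {cmonom W}) m :
  monomial_ideal A mu (monomial k m) <-> exists2 t, t \in A & mdvd (mu t) m.
Proof.
split=> [[c Ec]|[t tA tm]]; last first.
  exists (fun t' => if t' == t then << divcm m (mu t) >> else 0).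
  rewrite (bigD1 t) //= eqxx big1 => [|t' /andP[_ /negbTE ->]]; last by rewrite mul0r.
  by rewrite addr0 malgM_def fgmulUU mulr1 divcmK.
case: (boolP [exists t in A, mdvd (mu t) m]) => [/exists_inP[t]|/exists_inPn no].
  by exists t.
have := congr1 (mcoeff m) Ec; rewrite raddf_sum big1 => [|t /no/negbTE nt] /=.
  by rewrite /monomial mcoeffUU => /eqP; rewrite oner_eq0.
by rewrite mcoeff_mulmonom nt.
Qed.

Lemma letterplace_monomial_dvd (p : {ffun 'I_n -> P}) X :
  mdvd (letterplace_monomial p) (set_deg X) = [forall i, (i, p i) \in X].
Proof.
have E i q : letterplace_monomial p (i, q) = (p i == q).
  rewrite /letterplace_monomial.
  have evM : {morph (fun m : {cmonom V} => m (i, q)) : m m' / mmul m m' >-> (m + m')%N}.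
    by move=> m m'; rewrite cmM.
  rewrite (big_morph _ evM (cm1 _)).
  under eq_bigr do rewrite cmU.
  rewrite (bigD1 i) //= big1 => [|i' ii']; last by rewrite xpair_eqE (negbTE ii').
  by rewrite addn0 xpair_eqE eqxx.
apply/forallP/forallP => [H i|H [i q]].
  by have := H (i, p i); rewrite E eqxx set_degE; case: (_ \in _).
by rewrite E set_degE; case: eqP => // <-; rewrite H.
Qed.

Lemma letterplace_set_deg X :
  letterplace_ideal (monomial k (set_deg X)) <->
  has_chain (fun i j : 'I_n => (i <= j)%N) (fun p q : P => (p <= q)%O) X.
Proof.
split=> [/monomial_in_ideal[p]|[p mp pX]].
  by rewrite inE letterplace_monomial_dvd => mp /forallP pX; exists p.
apply/monomial_in_ideal; exists p; first by rewrite inE.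
by rewrite letterplace_monomial_dvd; apply/forallP.
Qed.

End Letterplace.

(** * Degrees with a nonzero Betti number *)

Section Support.
Context (k : fieldType) (d : Order.disp_t) (P : finPOrderType d).
Context (n i b : nat) (R : {set 'I_n * P}).
Hypothesis betti : is_betti (@letterplace_ideal n d P k) i (set_deg R) b.
Hypothesis b_neq0 : b <> 0%N.

Local Notation chain :=
  (has_chain (fun i j : 'I_n => (i <= j)%N) (fun p q : P => (p <= q)%O)).

Lemma betti_not_decided (A : {set 'I_n * P}) : A \subset R -> ~ decides A R chain.
Proof.
case: betti => F Fb AR dec; apply: b_neq0; rewrite -Fb.
apply: tor_dim_cube_exact; apply: (cube_exact_decision AR) => Y /dec[t tRA Ht].
exists t; first exact: tRA.
move=> X YX XY Jt; apply/letterplace_set_deg; apply: (Ht X YX XY).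
exact: (proj1 (letterplace_set_deg _) Jt).
Qed.

(** With an empty layer no subset of R carries a multichain, so all strands
    V(X) are exact with zero augmentation. *)
Lemma slice_neq0 j : slice R j != set0.
Proof.
apply/negP => /eqP Rj0; case: betti => F Fb; apply: b_neq0; rewrite -Fb.
apply: tor_dim_cube_exact; apply: cube_exact_void => X XR.
move=> /letterplace_set_deg[f _ fX].
have : f j \in slice R j by rewrite inE (subsetP XR).
by rewrite Rj0 inE.
Qed.

(** Otherwise every element of R_j below [q] has a maximal element of R_j above
    it that is not below [q], and [chain_toggle] applies. *)
Lemma exists_maximal_le (j j' : 'I_n) q : (j < j')%N -> q \in slice R j' ->
  exists2 p, p \in maximals (slice R j) & (p <= q)%O.
Proof.
move=> jj'; rewrite inE => Rq; apply/exists_inP.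
apply: contraT => /exists_inPn no; exfalso.
have sub : initial_part (fun i j : 'I_n => (i <= j)%N) (fun p q : P => (p <= q)%O)
    R j q \subset R by apply/subsetP => x; rewrite inE => /andP[].
apply: (betti_not_decided sub); apply: (@chain_toggle _ _ _ _ _ _ _ _ _ j') => //.
- by move=> ? ?; apply: leq_total.
- by move=> ? ? ?; apply: leq_trans.
- exact: le_trans.
- exact: ltnW.
- by rewrite -ltnNge.
move=> p Rp pq; have pS : p \in slice R j by rewrite inE.
have [p' pp' p'max] := @exists_extremal _ (fun x y : P => (x < y)%O) _ p
  (@ltxx _ _) (@lt_trans _ _) pS.
exists p'; split; last exact: no.
  by move: p'max; rewrite !inE => /andP[].
by case/orP: pp' => [/eqP ->//|/ltW].
Qed.

(** The mirror image of [exists_maximal_le]: layers and P carry the opposite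
    orders, which leaves the set of chains unchanged. *)
Lemma exists_minimal_ge (j j' : 'I_n) p : (j < j')%N -> p \in slice R j ->
  exists2 q, q \in minimals (slice R j') & (p <= q)%O.
Proof.
move=> jj'; rewrite inE => Rp; apply/exists_inP.
apply: contraT => /exists_inPn no; exfalso.
have sub : initial_part (fun i j : 'I_n => (j <= i)%N) (fun p q : P => (q <= p)%O)
    R j' p \subset R by apply/subsetP => x; rewrite inE => /andP[].
apply: (betti_not_decided sub) => Y YA.
have tot : total (fun i j : 'I_n => (j <= i)%N) by move=> x y; apply: leq_total.
have trI : transitive (fun i j : 'I_n => (j <= i)%N).
  by move=> x y z xy yz; apply: leq_trans yz xy.
have trP : transitive (fun p q : P => (q <= p)%O).
  by move=> x y z xy yz; apply: le_trans yz xy.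
have nj'j : ~~ (j' <= j)%N by rewrite -ltnNge.
have [q Rq pq|t tRA Ht] := chain_toggle tot trI trP (ltnW jj') nj'j Rp _ YA.
  have qS : q \in slice R j' by rewrite inE.
  have [q' qq' q'min] := @exists_extremal _ (fun x y : P => (y < x)%O) _ q
    (@ltxx _ _) (fun x y z xy yz => lt_trans yz xy) qS.
  exists q'; split; last exact: no.
    by move: q'min; rewrite !inE => /andP[].
  by case/orP: qq' => [/eqP ->//|/ltW].
exists t; first exact: tRA.
move=> X YX XY hc; apply/has_chain_op; apply: (Ht X YX XY).
exact/has_chain_op.
Qed.

End Support.

Local Close Scope ring_scope.

Theorem corollary3p11 (k : fieldType) (d : Order.disp_t) (P : finPOrderType d)
  (n i b : nat) (R : {set 'I_n * P}) :
  0 < n ->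
  is_betti (@letterplace_ideal n d P k) i (set_deg R) b ->
  b <> 0 ->
  (forall j : 'I_n, slice R j <> set0) /\
  (forall j j' : 'I_n, j.+1 = j' -> subset_le (slice R j) (slice R j')).
Proof.
move=> _ betti b0; have ne j : slice R j != set0 by apply: slice_neq0 betti b0 j.
split=> [j|j j' Ejj']; first exact/eqP.
have jj' : (j < j')%N by rewrite -Ejj'.
split=> // [p|q]; rewrite inE => /andP[Rpq _].
  by have := exists_minimal_ge betti b0 jj' Rpq.
by have := exists_maximal_le betti b0 jj' Rpq.
Qed.
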